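(* Let $(k,n)$ be a pair of integers such that $2\le k\le n$ and $n\ge 5$. Then there exists a connected graph $G$ such that $|V(G)|=n$, $\Delta(G)=n-3$, $\gamma(G)=2$ and $\gamma_{11}(G)=k$ if and only if $(k,n)\notin\{(4,5),(5,5),(4,6),(5,6),(6,6)\}$.
   Context: All graphs are finite, undirected, simple and connected. $\Delta(G)$ is the maximum degree of $G$. A set $S\subseteq V(G)$ is a dominating set if every vertex not in $S$ is adjacent to at least one vertex of $S$; the domination number $\gamma(G)$ is the minimum cardinality of a dominating set. A set $S\subseteq V(G)$ is a perfect dominating set if every vertex not in $S$ is adjacent to exactly one vertex of $S$ (in particular $S=V(G)$ is allowed); the perfect domination number $\gamma_{11}(G)$ is the minimum cardinality of a perfect dominating set. *)

(* Defs.v *)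
From mathcomp Require Import all_boot.

Set Implicit Arguments.
Unset Strict Implicit.
Unset Printing Implicit Defensive.

Record sgraph := SGraph {
  vertex :> finType;
  adj : rel vertex;
  adj_sym : symmetric adj;
  adj_irrefl : irreflexive adj
}.

Section GraphParameters.
Variable G : sgraph.
Implicit Types (x y : G) (S : {set G}).

Definition neighbors x : {set G} := [set y | adj x y].

Definition max_degree : nat := \max_(x : G) #|neighbors x|.

(* The null graph is not connected. *)
Definition connected_graph : bool :=
  (0 < #|G|) && [forall x : G, forall y : G, connect (@adj G) x y].

Definition dominating S : bool :=
  [forall x, (x \notin S) ==> (0 < #|neighbors x :&: S|)].

Definition perfect_dominating S : bool :=
  [forall x, (x \notin S) ==> (#|neighbors x :&: S| == 1)].

(* The default set [set: G] of each minimum below satisfies the constraint, so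
   these are the minimum cardinalities of (perfect) dominating sets. *)
Lemma dominating_setT : dominating [set: G].
Proof. by apply/forallP => x; rewrite inE. Qed.

Lemma perfect_dominating_setT : perfect_dominating [set: G].
Proof. by apply/forallP => x; rewrite inE. Qed.

Definition domination_number : nat :=
  #|[arg min_(S < [set: G] | dominating S) #|S|]|.

Definition perfect_domination_number : nat :=
  #|[arg min_(S < [set: G] | perfect_dominating S) #|S|]|.

End GraphParameters.

(* Main.v *)
Require Import Defs.
From mathcomp Require Import all_boot.

Set Implicit Arguments.
Unset Strict Implicit.
Unset Printing Implicit Defensive.

(** Existence rests on one construction: take a small core graph with a marked
    vertex [u] having exactly two non-neighbors, and hang [m] leaves on [u].
    Every leaf raises both the order and the degree of [u] by one, so the
    maximum degree stays at the order minus 3 as long as no other vertex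
    overtakes [u].  If [S] is a perfect dominating set avoiding [u], then [S]
    contains all the leaves, which all count as neighbors of [u]; so with two
    leaves or more [u] is forced into [S], and then leaves are useless in a
    minimum perfect dominating set.  From two leaves on, the perfect domination
    number therefore only depends on the core, while the order can be made as
    large as desired ([realize_with_leaves]).

    For k >= 6 the core is the join of two disjoint edges with k - 4 independent
    vertices, whose only perfect dominating set is the whole vertex set
    ([realize_join_graph]); there are n - k leaves, and fewer than two do no
    harm here.  For k = 2, 3, 4, 5 a core on five vertices is enough: the path,
    the cycle, and two graphs in which the neighborhood of [u], once hit by a
    perfect dominating set containing [u], is swallowed by it and drags the rest
    along ([realize_edge_graph]).  The path and the cycle work with any number
    of leaves; the last two cores have a vertex of degree 4, which is compatible
    with maximum degree n - 3 only from n = 7 on.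

    The five exceptional pairs have n = 5 or 6 and k > 3.  There, a vertex of
    maximum degree fixes one row of the adjacency matrix up to the order of the
    vertices, and a search through the remaining 2^6 or 2^10 matrices finds a
    perfect dominating set of size at most 3 whenever the domination number is
    at most 2 ([small_perfect_domination_number]). *)

(** * Domination parameters *)

Section Domination.
Variable G : sgraph.
Implicit Types (x y : G) (S T : {set G}).

Lemma domination_number_le S : dominating S -> domination_number G <= #|S|.
Proof.
move=> domS; rewrite /domination_number.
by case: arg_minnP => [|T _ minT]; [exact: dominating_setT | exact: minT].
Qed.

Lemma domination_numberE S : dominating S ->
  (forall T, dominating T -> #|S| <= #|T|) -> domination_number G = #|S|.
Proof.
move=> domS minS; apply/eqP; rewrite eqn_leq domination_number_le //=.
rewrite /domination_number; case: arg_minnP => [|T domT _].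
  exact: dominating_setT.
exact: minS.
Qed.

Lemma domination_number_witness :
  exists2 S : {set G}, dominating S & #|S| = domination_number G.
Proof.
rewrite /domination_number; case: arg_minnP => [|S domS _].
  exact: dominating_setT.
by exists S.
Qed.

Lemma perfect_domination_number_le S :
  perfect_dominating S -> perfect_domination_number G <= #|S|.
Proof.
move=> perS; rewrite /perfect_domination_number.
case: arg_minnP => [|T _ minT]; first exact: perfect_dominating_setT.
exact: minT.
Qed.

Lemma perfect_domination_numberE S : perfect_dominating S ->
  (forall T, perfect_dominating T -> #|S| <= #|T|) ->
  perfect_domination_number G = #|S|.
Proof.
move=> perS minS; apply/eqP; rewrite eqn_leq perfect_domination_number_le //=.
rewrite /perfect_domination_number; case: arg_minnP => [|T perT _].
  exact: perfect_dominating_setT.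
exact: minS.
Qed.

Lemma degree_le_max x : #|neighbors x| <= max_degree G.
Proof. exact: (leq_bigmax x). Qed.

(** A single dominating vertex would be adjacent to all the others. *)
Lemma dominating_ge2 S :
  (max_degree G).+1 < #|G| -> dominating S -> 1 < #|S|.
Proof.
move=> ltG /forallP domS; rewrite ltnNge; apply/negP => leS1.
have /card_gt0P[z _] : 0 < #|G| by exact: leq_trans ltG.
case: (set_0Vmem S) => [S0 | [t St]].
  by have := domS z; rewrite S0 inE setI0 cards0.
have S1 : S = [set t].
  by apply/eqP; rewrite eq_sym eqEcard sub1set St cards1.
have sub : ~: [set t] \subset neighbors t.
  apply/subsetP => x; rewrite !inE => xt; have := domS x.
  rewrite S1 inE xt /= => /card_gt0P[y]; rewrite !inE => /andP[xy /eqP <-].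
  by rewrite adj_sym.
have := leq_trans (subset_leq_card sub) (degree_le_max t).
rewrite cardsC1 -ltnS; case: #|G| ltG => // g; rewrite !ltnS.
by move=> /leq_trans H /H; rewrite ltnn.
Qed.

(** Every vertex is within distance 1 of [p] or [q], and [c] joins these two;
    this spares a separate path argument for each graph built below. *)
Lemma connected_dominating_pair (p c q : G) :
  dominating [set p; q] -> adj p c -> adj c q -> connected_graph G.
Proof.
move=> /forallP dom pc cq; have symG := @sym_connect_sym _ _ (@adj_sym G).
have pq : connect (@adj G) p q.
  exact: connect_trans (connect1 pc) (connect1 cq).
have to_p x : connect (@adj G) p x.
  have := dom x; rewrite !inE; case: eqVneq => [-> //|_] /=.
  case: eqVneq => [-> //|_] /= /card_gt0P[y]; rewrite !inE => /andP[xy].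
  have yx : connect (@adj G) y x by apply: connect1; rewrite adj_sym.
  by case/orP => /eqP yE; rewrite yE in yx; last apply: connect_trans pq _.
apply/andP; split; first by apply/card_gt0P; exists p.
apply/forallP => x; apply/forallP => y.
by apply: connect_trans (to_p y); rewrite symG.
Qed.

End Domination.

(** * Hanging leaves on a vertex *)

Lemma card_set_sum (A B : finType) (S : {set A + B}) :
  #|S| = #|inl @^-1: S| + #|inr @^-1: S|.
Proof.
rewrite -!sum1_card big_mkcond big_sumType -!big_mkcond /=.
by congr (_ + _); apply: eq_bigl => x; rewrite inE.
Qed.

Section Leaves.
Variables (G : sgraph) (u : G) (m : nat).

Definition leaves_adj (p q : G + 'I_m) : bool :=
  match p, q with
  | inl x, inl y => adj x y
  | inl x, inr _ => x == u
  | inr _, inl y => y == u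
  | inr _, inr _ => false
  end.

Lemma leaves_adj_sym : symmetric leaves_adj.
Proof. by move=> [x|i] [y|j] //=; apply: adj_sym. Qed.

Lemma leaves_adj_irrefl : irreflexive leaves_adj.
Proof. by move=> [x|i] //=; apply: adj_irrefl. Qed.

Definition with_leaves := SGraph leaves_adj_sym leaves_adj_irrefl.

Lemma card_with_leaves : #|with_leaves| = #|G| + m.
Proof. by rewrite card_sum card_ord. Qed.

Lemma card_neighbors_core (x : G) (S : {set with_leaves}) :
  #|neighbors (inl x : with_leaves) :&: S| =
  #|neighbors x :&: inl @^-1: S| + (x == u) * #|inr @^-1: S|.
Proof.
rewrite card_set_sum; congr (_ + _).
  by apply: eq_card => y; rewrite !inE.
by case xu: (x == u); rewrite ?mul1n ?mul0n;
  [apply: eq_card => i | apply: eq_card0 => i]; rewrite !inE /= xu.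
Qed.

Lemma card_neighbors_leaf (i : 'I_m) (S : {set with_leaves}) :
  #|neighbors (inr i : with_leaves) :&: S| = (inl u \in S).
Proof.
rewrite card_set_sum [X in _ + X]eq_card0 ?addn0; last first.
  by move=> j; rewrite !inE.
case uS: (inl u \in S) => /=.
  rewrite -(cards1 u); apply: eq_card => y; rewrite !inE /=.
  by case: eqP => // ->; rewrite uS.
by apply: eq_card0 => y; rewrite !inE /=; case: eqP => // ->; rewrite uS.
Qed.

(** The condition on [T] is the trace on [G] of perfect domination in the graph
    with leaves: if [u] is outside the set then all [m] leaves are inside, and
    they count both as neighbors of [u] and in the size of the set.  No
    [T] avoiding [u] satisfies it once [2 <= m].  The set [P] may be used
    unchanged in the larger graph because [u] dominates each leaf, being its
    only neighbor.  The pair [u, t] proves that the domination number is 2 and,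
    through the common neighbor [c], connectedness. *)
Lemma realize_with_leaves (k : nat) (t c : G) (P : {set G}) :
  #|neighbors u| + 3 = #|G| ->
  (forall x : G, #|neighbors x| <= #|neighbors u| + m) ->
  dominating [set u; t] -> adj u c -> adj c t ->
  perfect_dominating P -> u \in P -> #|P| = k ->
  (forall T : {set G},
     (forall x, x \notin T -> #|neighbors x :&: T| + (x == u) * m = 1) ->
     k <= #|T| + (u \notin T) * m) ->
  [/\ connected_graph with_leaves, #|with_leaves| = #|G| + m,
      max_degree with_leaves = #|G| + m - 3,
      domination_number with_leaves = 2
    & perfect_domination_number with_leaves = k].
Proof.
move=> degu degG dom uc ct perP uP cardP minT.
have degE x : #|neighbors (inl x : with_leaves)| =
    #|neighbors x| + (x == u) * m.
  rewrite -[neighbors _]setIT card_neighbors_core !preimsetT setIT.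
  by rewrite cardsT card_ord.
have degL i : #|neighbors (inr i : with_leaves)| = 1.
  by rewrite -[neighbors _]setIT card_neighbors_leaf inE.
have u0 : 0 < #|neighbors u| by apply/card_gt0P; exists c; rewrite inE.
have maxE : max_degree with_leaves = #|G| + m - 3.
  rewrite -degu addnAC addnK; apply/eqP; rewrite eqn_leq; apply/andP; split.
    apply/bigmax_leqP => -[x|i] _; last by rewrite degL addn_gt0 u0.
    rewrite degE; case: eqVneq => [->|_]; first by rewrite mul1n.
    by rewrite mul0n addn0.
  rewrite (leq_trans _ (degree_le_max (inl u : with_leaves))) //.
    by rewrite degE eqxx mul1n.
have domL : @dominating with_leaves [set inl u; inl t].
  apply/forallP => -[x|i]; last first.
    by apply/implyP => _; rewrite card_neighbors_leaf !inE eqxx.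
  apply/implyP => xS; rewrite card_neighbors_core.
  have preE : inl @^-1: ([set inl u; inl t] : {set with_leaves}) = [set u; t].
    by apply/setP => y; rewrite !inE.
  rewrite preE (leq_trans _ (leq_addr _ _)) //.
  by apply: (implyP (forallP dom x)); rewrite !inE in xS *.
have ltL : (max_degree with_leaves).+1 < #|with_leaves|.
  by rewrite maxE card_with_leaves -degu addnAC addnK addn3 !ltnS ltnW.
have cardD : #|[set inl u; inl t] : {set with_leaves}| = 2.
  apply/eqP; rewrite eqn_leq dominating_ge2 // andbT.
  by rewrite cardsU1 cards1 addn1 ltnS leq_b1.
split=> //.
- exact: (@connected_dominating_pair with_leaves _ (inl c) _ domL uc ct).
- exact: card_with_leaves.
- rewrite (domination_numberE domL) // => T domT.
  by rewrite cardD dominating_ge2.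
have perL : perfect_dominating (inl @: P : {set with_leaves}).
  have preE : inl @^-1: (inl @: P : {set with_leaves}) = P.
    by apply/setP => y; rewrite inE mem_imset //; apply: inl_inj.
  have preR : inr @^-1: (inl @: P : {set with_leaves}) = set0.
    by apply/setP => i; rewrite !inE; apply/imsetP => -[].
  apply/forallP => -[x|i]; apply/implyP.
    rewrite mem_imset; last exact: inl_inj.
    rewrite card_neighbors_core preE preR cards0 muln0 addn0.
    exact: (implyP (forallP perP x)).
  by rewrite card_neighbors_leaf mem_imset ?uP //; apply: inl_inj.
have cardL : #|inl @: P : {set with_leaves}| = k.
  by rewrite card_imset //; apply: inl_inj.
rewrite (perfect_domination_numberE perL) // => S /forallP perS.
rewrite cardL [leqRHS]card_set_sum; set T := inl @^-1: S.
(* A leaf has no neighbor but u to be dominated by. *)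
have leavesS : inl u \notin S -> #|inr @^-1: S| = m.
  move=> uS; rewrite -[RHS]card_ord -cardsT; apply: eq_card => i.
  rewrite !inE; have := perS (inr i); rewrite card_neighbors_leaf (negPf uS).
  by case: (inr i \in S).
have := minT T; rewrite inE; case uS: (inl u \in S) => /=.
  rewrite mul0n addn0 => H; apply: leq_trans (leq_addr _ _); apply: H => x xT.
  have xu : x != u by apply: contraNneq xT => ->; rewrite inE.
  have := implyP (perS (inl x)); rewrite card_neighbors_core (negPf xu) mul0n.
  by rewrite inE in xT => /(_ xT)/eqP.
rewrite mul1n leavesS ?uS //; apply=> x; rewrite inE => xS.
have := implyP (perS (inl x)) xS; rewrite card_neighbors_core leavesS ?uS //.
by move/eqP.
Qed.

End Leaves.

(** * Two disjoint edges joined to an independent set *)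

Section JoinGraph.
Variable b : nat.

(** The two edges live on [bool * bool]: the first component selects the edge,
    the second one of its ends. *)
Definition join_adj (p q : bool * bool + 'I_b) : bool :=
  match p, q with
  | inl x, inl y => (x.1 == y.1) && (x.2 != y.2)
  | inr _, inr _ => false
  | _, _ => true
  end.

Lemma join_adj_sym : symmetric join_adj.
Proof. by move=> [x|i] [y|j] //=; rewrite eq_sym [x.2 == _]eq_sym. Qed.

Lemma join_adj_irrefl : irreflexive join_adj.
Proof. by move=> [x|i] //=; rewrite !eqxx. Qed.

Definition join_graph := SGraph join_adj_sym join_adj_irrefl.

Let end_ (x y : bool) : join_graph := inl (x, y).
Let mid (i : 'I_b) : join_graph := inr i.

Lemma card_join_graph : #|join_graph| = b + 4.
Proof. by rewrite card_sum card_prod card_bool card_ord addnC. Qed.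

Lemma card_neighbors_end (x y : bool) (T : {set join_graph}) :
  #|neighbors (end_ x y) :&: T| =
  (end_ x (~~ y) \in T) + #|inr @^-1: T|.
Proof.
rewrite card_set_sum; congr (_ + _); last first.
  by apply: eq_card => i; rewrite !inE.
case eT: (end_ x (~~ y) \in T) => /=.
  rewrite -(cards1 (x, ~~ y)); apply: eq_card => -[z w].
  rewrite !inE /= xpair_eqE; case: eqVneq => // <-{z} /=.
  by case: y w eT => -[] //= ->.
apply: eq_card0 => -[z w]; rewrite !inE /=; case: eqVneq => // <-{z} /=.
by case: y w eT => -[] //= ->.
Qed.

Lemma card_neighbors_mid (i : 'I_b) (T : {set join_graph}) :
  #|neighbors (mid i) :&: T| = #|inl @^-1: T|.
Proof.
rewrite card_set_sum [X in _ + X]eq_card0 ?addn0; last first.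
  by move=> j; rewrite !inE.
by apply: eq_card => p; rewrite !inE.
Qed.

(** A vertex of the independent part outside [T] sees exactly one end [p] in
    [T].  The partner of [p] is then outside [T] and already sees [p], so no
    independent vertex is in [T]; but then the ends of the other edge see
    nothing.  Thus [T] contains the independent part, which has at least two
    vertices, all seen by each end: so the ends are in [T] too.  The bound
    [2 < b + m] is what the degree 4 of the independent vertices requires. *)
Lemma realize_join_graph (m : nat) : 1 < b -> 2 < b + m ->
  exists G : sgraph,
    [/\ connected_graph G, #|G| = b + 4 + m, max_degree G = b + 4 + m - 3,
        domination_number G = 2 & perfect_domination_number G = b + 4].
Proof.
move=> b2 bm; pose i0 : 'I_b := Ordinal (ltnW b2).
exists (with_leaves (end_ false false) m).
have degE x y : #|neighbors (end_ x y)| = b.+1.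
  rewrite -[neighbors _]setIT card_neighbors_end !inE preimsetT.
  by rewrite cardsT card_ord.
have degM i : #|neighbors (mid i)| = 4.
  rewrite -[neighbors _]setIT card_neighbors_mid preimsetT.
  by rewrite cardsT card_prod card_bool.
have dom : dominating [set end_ false false; end_ true false].
  apply/forallP => -[[x y]|i]; apply/implyP => xS; apply/card_gt0P.
    by exists (end_ x false); move: xS; rewrite !inE; case: x y => -[].
  by exists (end_ false false); rewrite !inE.
rewrite -card_join_graph.
apply: (realize_with_leaves (t := end_ true false) (c := mid i0)
  (P := [set: join_graph])) => //.
- by rewrite degE card_join_graph addSnnS.
- by move=> [[x y]|i]; rewrite !degE ?leq_addr // [leqLHS](degM i) addSn ltnS.
- exact: perfect_dominating_setT.
- exact: cardsT.
move=> T perT; suff -> : T = setT by rewrite cardsT card_join_graph leq_addr.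
have midT i : mid i \in T.
  apply/negPn/negP => iT; have := perT _ iT.
  rewrite card_neighbors_mid addn0 => /eqP/cards1P[[x y] endsT].
  have inT z w : (end_ z w \in T) = ((z == x) && (w == y)).
    by have /setP/(_ (z, w)) := endsT; rewrite !inE xpair_eqE.
  have q0 : #|inr @^-1: T| = 0.
    have /perT : end_ x (~~ y) \notin T.
      by rewrite inT; case: (y); rewrite andbF.
    rewrite card_neighbors_end negbK inT !eqxx /= add1n addSn => -[/eqP].
    by rewrite addn_eq0 => /andP[/eqP].
  (* The end (~~ x, true) rather than (~~ x, false), because the latter may be
     u, which the leaves could dominate. *)
  have /perT : end_ (~~ x) true \notin T by rewrite inT; case: (x).
  by rewrite card_neighbors_end inT q0; case: (x).
have qb : #|inr @^-1: T| = b.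
  by rewrite -[RHS]card_ord -cardsT; apply: eq_card => i; rewrite !inE midT.
apply/setP => -[[x y]|i]; rewrite inE; last exact: midT.
apply/negPn/negP => /perT; rewrite card_neighbors_end qb => E.
by have := b2; rewrite -E ltnNge -addnA addnCA leq_addr.
Qed.

End JoinGraph.

(** * Bit vectors for sets and adjacency *)

Section Codes.
Variables (G : sgraph) (v : seq G).
Hypotheses (uniq_v : uniq v) (mem_v : forall x, x \in v).

(** Relative to an enumeration [v] of the vertices, a set and a neighborhood
    become bit vectors, and [mask] plays the role of intersection, so that
    domination can be decided by evaluation. *)
Definition row_code (x : G) : bitseq := [seq adj x y | y <- v].
Definition set_code (S : {set G}) : bitseq := [seq x \in S | x <- v].

Lemma count_mask_row_code x (S : {set G}) :
  count id (mask (set_code S) (row_code x)) = #|neighbors x :&: S|.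
Proof.
rewrite -map_mask count_map -filter_mask count_filter -size_filter.
rewrite -(card_uniqP (filter_uniq _ uniq_v)); apply: eq_card => y.
by rewrite mem_filter mem_v !inE andbT.
Qed.

Lemma count_row_code (x : G) : count id (row_code x) = #|neighbors x|.
Proof.
rewrite count_map -size_filter -(card_uniqP (filter_uniq _ uniq_v)).
by apply: eq_card => y; rewrite mem_filter mem_v !inE andbT.
Qed.

Lemma count_set_code (S : {set G}) : count id (set_code S) = #|S|.
Proof.
rewrite count_map -size_filter -(card_uniqP (filter_uniq _ uniq_v)).
by apply: eq_card => y; rewrite mem_filter mem_v andbT.
Qed.

Lemma set_code_surj (s : bitseq) :
  size s = size v -> exists S : {set G}, set_code S = s.
Proof.
move=> sv; exists [set x in mask s v].
apply: (@eq_from_nth _ false); rewrite size_map // => i iv.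
have [x0 _] : exists x : G, True by case: v iv => // x; exists x.
by rewrite (nth_map x0) // inE in_mask // mem_nth // index_uniq.
Qed.

Lemma all2_set_codeP (T : Type) (f : G -> T) (p : T -> bool -> bool)
    (S : {set G}) :
  reflect (forall x, p (f x) (x \in S)) (all2 p (map f v) (set_code S)).
Proof.
have -> : all2 p (map f v) (set_code S) = all (fun x => p (f x) (x \in S)) v.
  by rewrite /set_code; elim: (v) => //= x w ->.
apply: (iffP allP) => [H x | H x _ //]; exact: H.
Qed.

End Codes.

Fixpoint bitseqs (n : nat) : seq bitseq :=
  if n is n'.+1 then [seq b :: s | b <- [:: true; false], s <- bitseqs n']
  else [:: [::]].

Lemma mem_bitseqs n (s : bitseq) : (s \in bitseqs n) = (size s == n).
Proof.
elim: n s => [|n IHn] s; first by case: s.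
apply/allpairsP/idP => [[[b s'] /= [_ + ->]] | ]; first by rewrite IHn.
case: s => // b s; rewrite eqSS -IHn => sn.
by exists (b, s); split=> //; case: (b).
Qed.

(** Both kinds of domination on codes: [p] tests the number of neighbors in the
    set, for each vertex outside the set. *)
Definition hits (p : pred nat) (M : seq bitseq) (s : bitseq) : bool :=
  all2 (fun r b => b || p (count id (mask s r))) M s.

Section Hits.
Variables (G : sgraph) (v : seq G).
Hypotheses (uniq_v : uniq v) (mem_v : forall x, x \in v).

Lemma dominating_code S :
  dominating S = hits (leq 1) (map (row_code v) v) (set_code v S).
Proof.
apply/forallP/(all2_set_codeP mem_v) => H x; have := H x;
  by rewrite count_mask_row_code // implyNb.
Qed.

Lemma perfect_dominating_code S :
  perfect_dominating S = hits (pred1 1) (map (row_code v) v) (set_code v S).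
Proof.
apply/forallP/(all2_set_codeP mem_v) => H x; have := H x;
  by rewrite count_mask_row_code // implyNb.
Qed.

End Hits.

(** * Cores on five vertices *)

Section EdgeGraph.
Variables (n : nat) (E : seq (nat * nat)).

Definition edge (i j : nat) : bool :=
  (i != j) && (((i, j) \in E) || ((j, i) \in E)).

Definition edge_adj (i j : 'I_n.+1) : bool := edge i j.

Lemma edge_adj_sym : symmetric edge_adj.
Proof. by move=> i j; rewrite /edge_adj /edge eq_sym orbC. Qed.

Lemma edge_adj_irrefl : irreflexive edge_adj.
Proof. by move=> i; rewrite /edge_adj /edge eqxx. Qed.

Definition edge_graph := SGraph edge_adj_sym edge_adj_irrefl.

Definition edge_row (i : nat) : bitseq := [seq edge i j | j <- iota 0 n.+1].

(** The hypotheses of [realize_with_leaves] on codes, with [u] the vertex 0. *)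
Definition core_check (k m t c : nat) (P : seq nat) : bool :=
  let vertices := iota 0 n.+1 in
  let rows := [seq edge_row i | i <- vertices] in
  let code Q := [seq i \in Q | i <- vertices] in
  [&& count id (edge_row 0) + 3 == n.+1,
      all (fun r => count id r <= count id (edge_row 0) + m) rows,
      [&& t <= n, c <= n, edge 0 c & edge c t],
      hits (leq 1) rows (code [:: 0; t]),
      [&& hits (pred1 1) rows (code P), 0 \in P & count id (code P) == k]
    & all (fun s =>
        all2 (fun i b =>
                b || (count id (mask s (edge_row i)) + (i == 0) * m == 1))
          vertices s ==>
        (k <= count id s + ~~ head false s * m)) (bitseqs n.+1)].

Lemma realize_edge_graph (k m t c : nat) (P : seq nat) :
  core_check k m t c P ->
  exists G : sgraph,
    [/\ connected_graph G, #|G| = n.+1 + m, max_degree G = n.+1 + m - 3,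
        domination_number G = 2 & perfect_domination_number G = k].
Proof.
pose v : seq edge_graph := enum 'I_n.+1.
have uv : uniq v by exact: enum_uniq.
have mv x : x \in v by exact: mem_enum.
have mapv (T : Type) (f : nat -> T) :
    [seq f i | i : 'I_n.+1 <- v] = [seq f i | i <- iota 0 n.+1].
  by rewrite -val_enum_ord -map_comp.
have rowE (x : edge_graph) : row_code v x = edge_row (x : 'I__) by exact: mapv.
have codeE (Q : seq nat) : set_code v [set i : 'I_n.+1 | val i \in Q] =
    [seq i \in Q | i <- iota 0 n.+1].
  by rewrite -mapv; apply: eq_map => i; rewrite inE.
have rowsE : map (row_code v) v = [seq edge_row i | i <- iota 0 n.+1].
  by rewrite -mapv; apply: eq_map.
have cardE : #|edge_graph| = n.+1 by exact: card_ord.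
case/and5P => /eqP deg0 /allP degs /and4P[tn cn e0c ect] dom.
case/andP => /and3P[per P0 /eqP cardP] /allP minT.
exists (with_leaves (ord0 : edge_graph) m).
have degE (x : edge_graph) : #|neighbors x| = count id (edge_row (x : 'I__)).
  by rewrite -(count_row_code uv mv) rowE.
have := @realize_with_leaves edge_graph ord0 m k (Ordinal (tn : t < n.+1))
  (Ordinal (cn : c < n.+1)) [set i : 'I_n.+1 | val i \in P].
rewrite cardE; apply.
- by rewrite degE deg0.
- move=> x; rewrite !degE; apply: degs; apply: map_f.
  by rewrite mem_iota /= ltn_ord.
- rewrite (dominating_code uv mv) rowsE.
  suff -> : [set (ord0 : edge_graph); Ordinal (tn : t < n.+1)] =
            [set i : 'I_n.+1 | val i \in [:: 0; t]] by rewrite codeE.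
  by apply/setP => i; rewrite !inE.
- exact: e0c.
- exact: ect.
- by rewrite (perfect_dominating_code uv mv) rowsE codeE.
- by rewrite inE.
- by rewrite -(count_set_code uv mv) codeE.
move=> T perT; have /minT : set_code v T \in bitseqs n.+1.
  by rewrite mem_bitseqs size_map -cardE cardT.
have -> : head false (set_code v T) = (ord0 \in T).
  by rewrite /set_code /v enum_ordSl.
rewrite (count_set_code uv mv) => /implyP; apply.
have <- : [seq val i | i : 'I_n.+1 <- v] = iota 0 n.+1 by exact: val_enum_ord.
apply/(all2_set_codeP mv) => x; rewrite -rowE (count_mask_row_code uv mv).
by apply/orP; case: (boolP (x \in T)) => [|/perT/eqP]; [left | right].
Qed.

End EdgeGraph.

(** The cores have the vertices 0, ..., 4, with 1 and 2 the neighbors of 0;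
    these edges are common to all four. *)
Definition shared_edges := [:: (0, 1); (0, 2); (1, 3)].

(** The path 2 0 1 3 4.  Here and below, the case distinction on [m] works
    because the check no longer depends on the number of leaves from two on. *)
Lemma core_check2 m : core_check 4 ((3, 4) :: shared_edges) 2 m 3 1 [:: 0; 4].
Proof. by case: m => [|[|m]]; vm_compute. Qed.

(** The cycle 0 1 3 4 2.  Besides 0 one more vertex is not enough: it would have
    to take care of both 3 and 4, hence be one of them, and then 1 or 2 would
    see two elements of the set. *)
Lemma core_check3 m :
  core_check 4 [:: (3, 4), (2, 4) & shared_edges] 3 m 3 1 [:: 0; 1; 2].
Proof. by case: m => [|[|m]]; vm_compute. Qed.

(** The triangle 1 2 3 with the pendant vertex 4 at 1.  With 0 in the set, 1
    brings 2 and conversely, since they are adjacent, and both bring 3.  One of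
    them has to be there: otherwise 3 would be undominated, or would be in the
    set and make 1 see both 0 and 3. *)
Lemma core_check4 m :
  core_check 4 [:: (1, 2), (2, 3), (1, 4) & shared_edges] 4 m.+2 1 2
    [:: 0; 1; 2; 3].
Proof. by vm_compute. Qed.

(** The complete graph on 1, 2, 3, 4.  With 0 in the set, any other element of
    the set brings 1 and 2, and these bring 3 and 4; there is another element
    because 0 does not dominate 3. *)
Lemma core_check5 m :
  core_check 4 [:: (1, 2), (2, 3), (1, 4), (2, 4), (3, 4) & shared_edges] 5 m.+2
    1 2 (iota 0 5).
Proof. by vm_compute. Qed.

(** * Exhaustive search for orders 5 and 6 *)

Definition add_vertex (r : bitseq) (M : seq bitseq) : seq bitseq :=
  (false :: r) :: [seq p.1 :: p.2 | p <- zip r M].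

Fixpoint adjacency_matrices (n : nat) : seq (seq bitseq) :=
  if n is n'.+1
  then [seq add_vertex r M | r <- bitseqs n', M <- adjacency_matrices n']
  else [:: [::]].

Section Matrix.
Variable G : sgraph.

Lemma matrix_cons (x : G) (v : seq G) :
  map (row_code (x :: v)) (x :: v) =
  add_vertex (row_code v x) (map (row_code v) v).
Proof.
rewrite /add_vertex /= adj_irrefl; congr (_ :: _).
rewrite /row_code zip_map -map_comp.
by apply: eq_map => y /=; rewrite adj_sym.
Qed.

Lemma mem_adjacency_matrices (v : seq G) :
  map (row_code v) v \in adjacency_matrices (size v).
Proof.
elim: v => // x v IHv; rewrite matrix_cons; apply: allpairs_f => //.
by rewrite mem_bitseqs size_map.
Qed.

End Matrix.

Definition matrix_check (n : nat) (M : seq bitseq) : bool :=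
  all (fun r => count id r <= n - 3) M ==>
  has (fun s => (count id s <= 2) && hits (leq 1) M s) (bitseqs n) ==>
  has (fun s => (count id s <= 3) && hits (pred1 1) M s) (bitseqs n).

(** The first row lists a vertex with [n - 3] neighbors, then these neighbors,
    then its two non-neighbors. *)
Definition small_check (n : nat) : bool :=
  let r0 := nseq (n - 3) true ++ [:: false; false] in
  all (fun M => matrix_check n (add_vertex r0 M)) (adjacency_matrices n.-1).

Lemma small_check5 : small_check 5. Proof. by vm_compute. Qed.
Lemma small_check6 : small_check 6. Proof. by vm_compute. Qed.

(** Enumerating the vertices as [u], its neighbors, its non-neighbors, for [u]
    of maximum degree, puts the adjacency matrix in the form searched. *)
Lemma small_perfect_domination_number (G : sgraph) :
  2 < #|G| -> small_check #|G| -> max_degree G = #|G| - 3 ->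
  domination_number G <= 2 -> perfect_domination_number G <= 3.
Proof.
move=> n3 chk maxE dom2.
have [u degu] : {u : G | max_degree G = #|neighbors u|}.
  by apply: eq_bigmax; exact: leq_trans n3.
pose far := ~: (u |: neighbors u).
pose v := u :: enum (neighbors u) ++ enum far.
have mv x : x \in v.
  rewrite inE mem_cat !mem_enum !inE; case: eqVneq => //= _.
  exact: orbN.
have uv : uniq v.
  rewrite /= mem_cat !mem_enum !inE eqxx adj_irrefl /=.
  rewrite cat_uniq !enum_uniq andbT /=.
  by apply/hasPn => x; rewrite !mem_enum !inE negb_or => /andP[_ ->].
have sv : size v = #|G|.
  by rewrite -(card_uniqP uv); apply: eq_card => x; rewrite mv.
have row0 : row_code (behead v) u = nseq (#|G| - 3) true ++ [:: false; false].
  have sfar : size (enum far) = 2.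
    move: sv; rewrite /v /= size_cat -cardE -degu maxE => sv.
    apply/eqP; rewrite -(eqn_add2l (#|G| - 3)) -eqSS sv addn2 -addn3.
    by rewrite subnK.
  rewrite /row_code map_cat -maxE degu cardE.
  have constant_row (b : bool) (s : seq G) : {in s, forall y, adj u y = b} ->
      [seq adj u y | y <- s] = nseq (size s) b.
    elim: s => //= y s IHs H; rewrite H ?mem_head // IHs // => z zs.
    by rewrite H // inE zs orbT.
  rewrite (constant_row true) => [|y]; last by rewrite mem_enum inE.
  rewrite (constant_row false) ?sfar // => y.
  by rewrite mem_enum !inE negb_or => /andP[_ /negPf].
have sbv : size (behead v) = #|G|.-1 by rewrite -sv.
have chkM := allP chk (map (row_code (behead v)) (behead v)).
move: chkM; rewrite -sbv mem_adjacency_matrices => /(_ isT).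
rewrite -row0 -matrix_cons -/v.
have degs : all (fun r => count id r <= #|G| - 3) (map (row_code v) v).
  apply/allP => r /mapP[x _ ->]; rewrite (count_row_code uv mv) -maxE.
  exact: degree_le_max.
rewrite /matrix_check degs; have [D domD cardD] := domination_number_witness G.
have -> : has (fun s => (count id s <= 2) &&
                        hits (leq 1) (map (row_code v) v) s) (bitseqs #|G|).
  apply/hasP; exists (set_code v D); first by rewrite mem_bitseqs size_map sv.
  by rewrite (count_set_code uv mv) cardD dom2 -(dominating_code uv mv).
case/hasP => s; rewrite mem_bitseqs -sv => /eqP/(set_code_surj uv)[S <-].
rewrite (count_set_code uv mv) -(perfect_dominating_code uv mv).
by case/andP => S3 /perfect_domination_number_le/leq_trans; apply.
Qed.

Theorem theorem3 (k n : nat) (hk : 2 <= k <= n) (hn : 5 <= n) :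
  (exists G : sgraph,
     [/\ connected_graph G, #|G| = n, max_degree G = n - 3,
         domination_number G = 2 & perfect_domination_number G = k])
  <-> (k, n) \notin [:: (4, 5); (5, 5); (4, 6); (5, 6); (6, 6)].
Proof.
split=> [[G [_ cardG maxG dom2 perk]] | ].
  have small : small_check n -> k <= 3.
    move=> chk; rewrite -perk small_perfect_domination_number ?cardG ?dom2 //.
    exact: leq_trans hn.
  apply/negP; rewrite !inE !xpair_eqE.
  by case/or4P => [|||/orP[]] /andP[/eqP kE /eqP nE];
    move: small; rewrite kE nE ?small_check5 ?small_check6 => /(_ isT).
case/andP: hk => k2 kn kn_ok.
have n7 : 3 < k -> 6 < n.
  move: kn_ok hn kn; case: n => [|[|[|[|[|[|[|n]]]]]]] //;
  by case: k {k2} => [|[|[|[|[|[|[|k]]]]]]].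
have nE : n = 5 + (n - 5) by rewrite subnKC.
have nE7 : 3 < k -> n = 5 + (n - 7).+2.
  by move/n7 => n7'; rewrite -!addSnnS subnKC.
case: (leqP k 5) => [k5 | k6].
  move: k2 k5 nE7; case: k {kn kn_ok n7} => [|[|[|[|[|[|k]]]]]] // _ _ nE7.
  - by rewrite nE; apply: realize_edge_graph (core_check2 _).
  - by rewrite nE; apply: realize_edge_graph (core_check3 _).
  - by rewrite nE7 //; apply: realize_edge_graph (core_check4 _).
  - by rewrite nE7 //; apply: realize_edge_graph (core_check5 _).
have k4 : k - 4 + 4 = k by rewrite subnK // (leq_trans _ k6).
have := @realize_join_graph (k - 4) (n - k).
rewrite k4 subnKC //; apply.
  by rewrite -(leq_add2r 4) k4.
by rewrite -(leq_add2r 4) addnAC k4 subnKC // n7 // (leq_trans _ k6).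
Qed.
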